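(* If $n\geq 3$ is odd then $B_n/[P_n,P_n]$ possesses infinitely many elements of order $n$.
   Context: $B_n$ is the Artin braid group with generators $\sigma_1,\ldots,\sigma_{n-1}$ and relations $\sigma_i\sigma_j=\sigma_j\sigma_i$ for $|i-j|\geq 2$, and $\sigma_{i+1}\sigma_i\sigma_{i+1}=\sigma_i\sigma_{i+1}\sigma_i$ for $1\leq i\leq n-2$. $P_n$ is the pure braid group, i.e. the kernel of the homomorphism $\sigma\colon B_n\to S_n$ with $\sigma(\sigma_i)=(i,i+1)$, and $[P_n,P_n]$ is its commutator subgroup. *)

(* Defs.v *)
From HB Require Import structures.
From mathcomp Require Import fingroup perm.
From mathcomp Require Import all_boot.
From mathcomp Require Import boolp classical_sets cardinality.
From mathcomp Require Import zify.

Set Implicit Arguments.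
Unset Strict Implicit.
Unset Printing Implicit Defensive.

Local Open Scope quotient_scope.
Local Open Scope classical_set_scope.
Local Open Scope group_scope.

(* MathComp's groupType is the class of arbitrary, possibly infinite, groups; *)
(* the {group gT} theory of fingroup does not apply to it.                    *)

Section Subgroups.
Variable G : groupType.
Implicit Types (A H : set G) (x y : G).

Definition is_subgroup H := H 1 /\ forall x y, H x -> H y -> H (x / y).

Definition is_normal H := forall x y, H x -> H (x ^ y).

Definition generated A : set G :=
  [set x | forall H, is_subgroup H -> A `<=` H -> H x].

Definition commutator_subgroup A : set G :=
  generated [set z | exists x y, [/\ A x, A y & z = [~ x, y]]].

Record normal_subgroup := NormalSubgroup {
  normal_carrier :> set G;
  normal_is_subgroup : is_subgroup normal_carrier;
  normal_is_normal : is_normal normal_carrier }.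

Lemma generated_is_subgroup A : is_subgroup (generated A).
Proof.
split=> [H [H1 _] _ //|x y Ax Ay H sgH sAH].
by case: (sgH) => _; apply; [exact: Ax | exact: Ay].
Qed.

Lemma preim_conj_subgroup H y :
  is_subgroup H -> is_subgroup [set x | H (x ^ y)].
Proof.
case=> H1 HB; split=> /= [|a b Ha Hb]; first by rewrite conj1g.
by rewrite conjMg conjVg; exact: HB.
Qed.

Lemma generated_is_normal A :
  (forall x y, A x -> A (x ^ y)) -> is_normal (generated A).
Proof.
move=> nA x y Ax H sgH sAH.
have sg := preim_conj_subgroup y sgH.
by apply: (Ax _ sg) => a Aa; apply: sAH; apply: nA.
Qed.

Lemma commutator_subgroup_is_subgroup A : is_subgroup (commutator_subgroup A).
Proof. exact: generated_is_subgroup. Qed.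

Lemma commutator_subgroup_is_normal A :
  is_normal A -> is_normal (commutator_subgroup A).
Proof.
move=> nA; apply: generated_is_normal => z t [x [y [Ax Ay ->]]].
by exists (x ^ t), (y ^ t); split; [exact: nA | exact: nA | rewrite conjRg].
Qed.

Definition derived (N : normal_subgroup) : normal_subgroup :=
  NormalSubgroup (commutator_subgroup_is_subgroup N)
                 (commutator_subgroup_is_normal (@normal_is_normal N)).

Definition has_order x (m : nat) :=
  [/\ (0 < m)%N, x ^+ m = 1 & forall k : nat, (0 < k < m)%N -> x ^+ k <> 1].

End Subgroups.

Section Kernel.
Variables (G H : groupType) (f : UMagmaMorphism.type G H).

Definition kernel : set G := [set x | f x = 1].

Lemma kernel_is_subgroup : is_subgroup kernel.
Proof.
split=> [|x y]; rewrite /kernel /=; first exact: gmulf1.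
by move=> fx fy; rewrite gmulfF fx fy divgg.
Qed.

Lemma kernel_is_normal : is_normal kernel.
Proof.
by move=> x y; rewrite /kernel /= => fx; rewrite gmulfJ fx conj1g.
Qed.

Definition kernel_subgroup : normal_subgroup G :=
  NormalSubgroup kernel_is_subgroup kernel_is_normal.

End Kernel.

Section QuotientGroup.
Variables (G : groupType) (N : normal_subgroup G).

Definition coset_rel : rel G := fun x y => `[< normal_carrier N (x / y) >].

Lemma normal1 : normal_carrier N 1. Proof. by case: (normal_is_subgroup N). Qed.

Lemma normalB x y : normal_carrier N x -> normal_carrier N y -> normal_carrier N (x / y).
Proof. by case: (normal_is_subgroup N) => _; apply. Qed.

Lemma normalV x : normal_carrier N x -> normal_carrier N x^-1.
Proof. by move=> Nx; rewrite -[x^-1]mul1g; apply: normalB => //; exact: normal1. Qed.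

Lemma normalM x y : normal_carrier N x -> normal_carrier N y -> normal_carrier N (x * y).
Proof. by move=> Nx Ny; rewrite -[y]invgK; apply: normalB => //; exact: normalV. Qed.

Lemma normalJ x y : normal_carrier N x -> normal_carrier N (x ^ y).
Proof. exact: normal_is_normal. Qed.

Lemma coset_rel_refl : reflexive coset_rel.
Proof. by move=> x; apply/asboolP; rewrite divgg; exact: normal1. Qed.

Lemma coset_rel_sym : symmetric coset_rel.
Proof.
suff h x y : coset_rel x y -> coset_rel y x by move=> x y; apply/idP/idP; exact: h.
by move=> /asboolP Nxy; apply/asboolP; rewrite -invgF; exact: normalV.
Qed.

Lemma coset_rel_trans : transitive coset_rel.
Proof.
move=> y x z /asboolP Nxy /asboolP Nyz; apply/asboolP.
by have := normalM Nxy Nyz; rewrite mulgA mulgVK.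
Qed.

Canonical coset_equiv :=
  EquivRel coset_rel coset_rel_refl coset_rel_sym coset_rel_trans.

Definition quotient_group := {eq_quot coset_equiv}.

HB.instance Definition _ := Choice.on quotient_group.
HB.instance Definition _ : EqQuotient G coset_equiv quotient_group :=
  EqQuotient.on quotient_group.

Definition quotient_one : quotient_group := \pi_quotient_group 1.
Definition quotient_mul (x y : quotient_group) : quotient_group :=
  \pi_quotient_group (repr x * repr y).
Definition quotient_inv (x : quotient_group) : quotient_group :=
  \pi_quotient_group (repr x)^-1.

Lemma quotient_ind (P : quotient_group -> Prop) :
  (forall x, P (\pi_quotient_group x)) -> forall q, P q.
Proof. by move=> h q; rewrite -[q]reprK; exact: h. Qed.

Lemma quotient_eqP (x y : G) :
  \pi_quotient_group x = \pi_quotient_group y <-> normal_carrier N (x / y).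
Proof.
split=> [/eqmodP/asboolP //|Nxy].
by apply/eqmodP; apply/asboolP.
Qed.

Lemma quotient_mulE (x y : G) :
  quotient_mul (\pi_quotient_group x) (\pi_quotient_group y)
  = \pi_quotient_group (x * y).
Proof.
apply/quotient_eqP.
have /quotient_eqP Nx := reprK (\pi_quotient_group x).
have /quotient_eqP Ny := reprK (\pi_quotient_group y).
set x' := repr _ in Nx *; set y' := repr _ in Ny *.
have -> : x' * y' / (x * y) = (y' / y) ^ x'^-1 * (x' / x).
  by rewrite /conjg invgK invgM !mulgA mulgVK.
exact: normalM (normalJ _ Ny) Nx.
Qed.

Lemma quotient_invE (x : G) :
  quotient_inv (\pi_quotient_group x) = \pi_quotient_group x^-1.
Proof.
apply/quotient_eqP.
have /quotient_eqP Nx := reprK (\pi_quotient_group x).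
set x' := repr _ in Nx *.
have -> : x'^-1 / x^-1 = ((x' / x) ^ x')^-1.
  by rewrite /conjg -mulgA mulKg invgM !invgK.
exact/normalV/normalJ.
Qed.

Lemma quotient_mulA : associative quotient_mul.
Proof.
move=> x y z; elim/quotient_ind: x => x; elim/quotient_ind: y => y; elim/quotient_ind: z => z.
by rewrite !quotient_mulE mulgA.
Qed.

Lemma quotient_mul1g : left_id quotient_one quotient_mul.
Proof. by move=> x; elim/quotient_ind: x => x; rewrite quotient_mulE mul1g. Qed.

Lemma quotient_mulg1 : right_id quotient_one quotient_mul.
Proof. by move=> x; elim/quotient_ind: x => x; rewrite quotient_mulE mulg1. Qed.

Lemma quotient_mulVg : left_inverse quotient_one quotient_inv quotient_mul.
Proof. by move=> x; elim/quotient_ind: x => x; rewrite quotient_invE quotient_mulE mulVg. Qed.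

Lemma quotient_mulgV : right_inverse quotient_one quotient_inv quotient_mul.
Proof. by move=> x; elim/quotient_ind: x => x; rewrite quotient_invE quotient_mulE mulgV. Qed.

HB.instance Definition _ := isGroup.Build quotient_group
  quotient_mulA quotient_mul1g quotient_mulg1 quotient_mulVg quotient_mulgV.

End QuotientGroup.

(* A letter (i, true) stands for the generator i, (i, false) for its inverse. *)
Notation word I := (seq (I * bool)).

Section Presentation.
Variables (I : choiceType) (R : word I -> word I -> Prop).

Inductive pres_eq : word I -> word I -> Prop :=
| pres_refl u : pres_eq u u
| pres_sym u v : pres_eq u v -> pres_eq v u
| pres_trans u v w : pres_eq u v -> pres_eq v w -> pres_eq u w
| pres_cat u u' v v' : pres_eq u u' -> pres_eq v v' -> pres_eq (u ++ v) (u' ++ v')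
| pres_cancel i b : pres_eq [:: (i, b); (i, ~~ b)] [::]
| pres_rel u v : R u v -> pres_eq u v.

Definition pres_eqb : rel (word I) := fun u v => `[< pres_eq u v >].

Lemma pres_eqb_refl : reflexive pres_eqb.
Proof. by move=> u; apply/asboolP; exact: pres_refl. Qed.

Lemma pres_eqb_sym : symmetric pres_eqb.
Proof. by move=> u v; apply/asboolP/asboolP; exact: pres_sym. Qed.

Lemma pres_eqb_trans : transitive pres_eqb.
Proof.
by move=> v u w /asboolP uv /asboolP vw; apply/asboolP; exact: pres_trans uv vw.
Qed.

Canonical pres_equiv :=
  EquivRel pres_eqb pres_eqb_refl pres_eqb_sym pres_eqb_trans.

Definition presented_group := {eq_quot pres_equiv}.

HB.instance Definition _ := Choice.on presented_group.
HB.instance Definition _ : EqQuotient (word I) pres_equiv presented_group :=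
  EqQuotient.on presented_group.

Definition word_inv (u : word I) : word I := rev [seq (a.1, ~~ a.2) | a <- u].

Definition pres_one : presented_group := \pi_presented_group [::].
Definition pres_mul (x y : presented_group) : presented_group :=
  \pi_presented_group (repr x ++ repr y).
Definition pres_inv (x : presented_group) : presented_group :=
  \pi_presented_group (word_inv (repr x)).
Definition pres_gen (i : I) : presented_group :=
  \pi_presented_group [:: (i, true)].

Lemma pres_ind (P : presented_group -> Prop) :
  (forall u, P (\pi_presented_group u)) -> forall x, P x.
Proof. by move=> h x; rewrite -[x]reprK; exact: h. Qed.

Lemma pres_eqP (u v : word I) :
  \pi_presented_group u = \pi_presented_group v <-> pres_eq u v.
Proof.
split=> [/eqmodP/asboolP //|uv].
by apply/eqmodP; apply/asboolP.
Qed.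

Lemma repr_pres_eq (u : word I) : pres_eq (repr (\pi_presented_group u)) u.
Proof. by apply/pres_eqP; rewrite reprK. Qed.

Lemma word_inv_cat (u v : word I) : word_inv (u ++ v) = word_inv v ++ word_inv u.
Proof. by rewrite /word_inv map_cat rev_cat. Qed.

Lemma word_invK : involutive word_inv.
Proof.
move=> u; rewrite /word_inv map_rev revK -map_comp -[RHS]map_id.
by apply: eq_map => -[i b] /=; rewrite negbK.
Qed.

Lemma pres_eq_mulgV (u : word I) : pres_eq (u ++ word_inv u) [::].
Proof.
elim: u => [|[i b] u IHu]; first exact: pres_refl.
have -> : ((i, b) :: u) ++ word_inv ((i, b) :: u)
        = [:: (i, b)] ++ ((u ++ word_inv u) ++ [:: (i, ~~ b)]).
  by rewrite -cat1s word_inv_cat -!catA.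
apply: pres_trans (pres_cancel i b).
apply: (@pres_cat [:: (i, b)] [:: (i, b)] _ [:: (i, ~~ b)]); first exact: pres_refl.
exact: (@pres_cat _ [::] _ [:: (i, ~~ b)] IHu (pres_refl _)).
Qed.

Lemma pres_eq_mulVg (u : word I) : pres_eq (word_inv u ++ u) [::].
Proof. by have := pres_eq_mulgV (word_inv u); rewrite word_invK. Qed.

Lemma pres_eq_inv (u v : word I) : pres_eq u v -> pres_eq (word_inv u) (word_inv v).
Proof.
move=> uv.
have h1 : pres_eq (word_inv u) (word_inv u ++ (v ++ word_inv v)).
  rewrite -{1}[word_inv u]cats0.
  by apply: pres_cat; [exact: pres_refl | apply: pres_sym; exact: pres_eq_mulgV].
apply: pres_trans h1 _; rewrite catA -{2}[word_inv v]cat0s.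
apply: pres_cat; last exact: pres_refl.
apply: pres_trans (pres_eq_mulVg u).
by apply: pres_cat; [exact: pres_refl | exact: pres_sym].
Qed.

Lemma pres_mulE (u v : word I) :
  pres_mul (\pi_presented_group u) (\pi_presented_group v)
  = \pi_presented_group (u ++ v).
Proof. by apply/pres_eqP; apply: pres_cat; exact: repr_pres_eq. Qed.

Lemma pres_invE (u : word I) :
  pres_inv (\pi_presented_group u) = \pi_presented_group (word_inv u).
Proof. by apply/pres_eqP; apply: pres_eq_inv; exact: repr_pres_eq. Qed.

Lemma pres_mulA : associative pres_mul.
Proof.
move=> x y z; elim/pres_ind: x => x; elim/pres_ind: y => y; elim/pres_ind: z => z.
by rewrite !pres_mulE catA.
Qed.

Lemma pres_mul1g : left_id pres_one pres_mul.
Proof. by move=> x; elim/pres_ind: x => x; rewrite pres_mulE. Qed.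

Lemma pres_mulg1 : right_id pres_one pres_mul.
Proof. by move=> x; elim/pres_ind: x => x; rewrite pres_mulE cats0. Qed.

Lemma pres_mulVg : left_inverse pres_one pres_inv pres_mul.
Proof.
by move=> x; elim/pres_ind: x => x; rewrite pres_invE pres_mulE; apply/pres_eqP; exact: pres_eq_mulVg.
Qed.

Lemma pres_mulgV : right_inverse pres_one pres_inv pres_mul.
Proof.
by move=> x; elim/pres_ind: x => x; rewrite pres_invE pres_mulE; apply/pres_eqP; exact: pres_eq_mulgV.
Qed.

HB.instance Definition _ := isGroup.Build presented_group
  pres_mulA pres_mul1g pres_mulg1 pres_mulVg pres_mulgV.

Section Lift.
Variables (H : groupType) (f : I -> H).

Definition word_eval (u : word I) : H :=
  \prod_(a <- u) (if a.2 then f a.1 else (f a.1)^-1).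

Hypothesis fR : forall u v, R u v -> word_eval u = word_eval v.

Lemma word_eval_cat (u v : word I) : word_eval (u ++ v) = word_eval u * word_eval v.
Proof. by rewrite /word_eval big_cat. Qed.

Lemma word_eval_pres_eq (u v : word I) : pres_eq u v -> word_eval u = word_eval v.
Proof.
elim=> //.
- by move=> ? ? ? _ -> _ ->.
- by move=> ? ? ? ? _ e1 _ e2; rewrite !word_eval_cat e1 e2.
- move=> i b; rewrite /word_eval !big_cons big_nil mulg1 /=.
  by case: b; rewrite /= ?mulgV ?mulVg.
Qed.

Definition pres_lift of (forall u v, R u v -> word_eval u = word_eval v) :
  presented_group -> H := fun x => word_eval (repr x).

Lemma pres_liftE (u : word I) :
  pres_lift fR (\pi_presented_group u) = word_eval u.
Proof. exact/word_eval_pres_eq/repr_pres_eq. Qed.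

Lemma pres_lift_gen (i : I) : pres_lift fR (pres_gen i) = f i.
Proof. by rewrite pres_liftE /word_eval big_seq1. Qed.

Lemma pres_lift_is_monoid_morphism : monoid_morphism (pres_lift fR).
Proof.
split; first by rewrite pres_liftE /word_eval big_nil.
move=> x y; elim/pres_ind: x => u; elim/pres_ind: y => v.
by rewrite [_ * _]pres_mulE !pres_liftE word_eval_cat.
Qed.

HB.instance Definition _ := isUMagmaMorphism.Build presented_group H
  (pres_lift fR) pres_lift_is_monoid_morphism.

End Lift.
End Presentation.

Section Braids.
Variable n : nat.

(* The index i : 'I_n.-1, counted from 0, stands for the i.+1-st Artin *)
(* generator, and the points permuted by 'S_n are 0, ..., n.-1.        *)
(* The product of 'S_n applies its left factor first; the kernel of    *)
(* braid_perm does not depend on this choice.                          *)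
Definition letter (i : 'I_n.-1) : 'I_n.-1 * bool := (i, true).

Inductive braid_rel : word 'I_n.-1 -> word 'I_n.-1 -> Prop :=
| braid_rel_far (i j : 'I_n.-1) : (i.+2 <= j)%N || (j.+2 <= i)%N ->
    braid_rel [:: letter i; letter j] [:: letter j; letter i]
| braid_rel_adjacent (i j : 'I_n.-1) : j = i.+1 :> nat ->
    braid_rel [:: letter j; letter i; letter j] [:: letter i; letter j; letter i].

Definition braid_group := presented_group braid_rel.
HB.instance Definition _ := Group.on braid_group.

Lemma succ_subproof (i : 'I_n.-1) : (i.+1 < n)%N.
Proof. by rewrite -ltn_predRL. Qed.

Definition adjacent_transposition (i : 'I_n.-1) : 'S_n :=
  tperm (widen_ord (leq_pred n) i) (Ordinal (succ_subproof i)).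

Lemma adjacent_transposition_rel (u v : word 'I_n.-1) :
  braid_rel u v ->
  word_eval adjacent_transposition u = word_eval adjacent_transposition v.
Proof.
case=> i j h; rewrite /word_eval !big_cons !big_nil /= !mulg1.
- suff e : adjacent_transposition i ^ adjacent_transposition j
           = adjacent_transposition i by rewrite conjgC e.
  rewrite /adjacent_transposition tpermJ.
  by congr tperm; apply: tpermD; apply/eqP => /(congr1 val) /= e; lia.
- set s := adjacent_transposition i; set t := adjacent_transposition j.
  have tV : t^-1 = t by exact: tpermV.
  have sV : s^-1 = s by exact: tpermV.
  have -> : t * (s * t) = s ^ t by rewrite /conjg tV.
  have -> : s * (t * s) = t ^ s by rewrite /conjg sV.
  have b : Ordinal (succ_subproof i) = widen_ord (leq_pred n) j by exact: val_inj.
  rewrite /s /t /adjacent_transposition !tpermJ -b tpermL tpermR.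
  by congr tperm; [|apply/esym]; apply: tpermD; apply/eqP => /(congr1 val) /= e; lia.
Qed.

Definition braid_perm : braid_group -> 'S_n := pres_lift adjacent_transposition_rel.
HB.instance Definition _ := UMagmaMorphism.on braid_perm.

Definition pure_braid_group : normal_subgroup braid_group :=
  kernel_subgroup braid_perm.

End Braids.

(* Main.v *)
(* Modulo [P_n, P_n] the group P_n becomes an abelian group on which B_n acts by
   conjugation, each Artin generator acting as an involution. The braid
   delta = s_1 ... s_(n-1) acts by the cyclic shift on the n(n-1)/2 band classes
   A_(i,j), the conjugates of the s_i^2, and delta^n is the full twist, the sum
   of all A_(i,j). For odd n every orbit of the shift has n elements, so if b is
   a sum of orbit representatives, (b^-1 delta)^n = 1. Conjugating b^-1 delta by
   the powers of s_1^2 gives infinitely many elements: they are told apart by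
   counting, strand by strand, the signed crossings, a homomorphism from B_n to
   the wreath product of Z and S_n that sends P_n into an abelian group. *)

From HB Require Import structures.
From mathcomp Require Import fingroup perm ssralg ssrint.
From mathcomp Require Import all_boot.
From mathcomp Require Import boolp classical_sets cardinality.
From mathcomp Require Import zify.
Require Import Defs.

Set Implicit Arguments.
Unset Strict Implicit.
Unset Printing Implicit Defensive.

Local Open Scope quotient_scope.
Local Open Scope classical_set_scope.
Local Open Scope group_scope.

(** * Abelian normal subgroups as additive groups acted on by conjugation *)

Record abelian_normal_subgroup (G : groupType) := AbelianNormalSubgroup {
  abelian_carrier :> normal_subgroup G;
  abelian_commute : forall x y, normal_carrier abelian_carrier x ->
    normal_carrier abelian_carrier y -> commute x y }.

Section ConjugationModule.
Variables (G : groupType) (M : abelian_normal_subgroup G).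

Definition module_of := {x : G | `[< normal_carrier M x >]}.
HB.instance Definition _ := SubChoice.on module_of.
Implicit Types (u v : module_of) (g h : G).

Definition mval u : G := val u.

Lemma mval_inj : injective mval. Proof. exact: val_inj. Qed.

Lemma mvalP u : normal_carrier M (mval u).
Proof. by apply/asboolP; exact: (valP u). Qed.

Definition to_module (x : G) (Mx : normal_carrier M x) : module_of :=
  exist _ x (introT (asboolP _) Mx).

Lemma mvalE x (Mx : normal_carrier M x) : mval (to_module Mx) = x.
Proof. by []. Qed.

Definition module_add u v :=
  to_module (normalM (mvalP u) (mvalP v)).
Definition module_opp u := to_module (normalV (mvalP u)).
Definition module_zero := to_module (normal1 M).

Lemma module_addA : associative module_add.
Proof. by move=> u v w; apply: mval_inj; rewrite !mvalE mulgA. Qed.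

Lemma module_addC : commutative module_add.
Proof.
by move=> u v; apply: mval_inj; apply: abelian_commute; exact: mvalP.
Qed.

Lemma module_add0 : left_id module_zero module_add.
Proof. by move=> u; apply: mval_inj; rewrite !mvalE mul1g. Qed.

Lemma module_addN : left_inverse module_zero module_opp module_add.
Proof. by move=> u; apply: mval_inj; rewrite !mvalE mulVg. Qed.

HB.instance Definition _ := GRing.isZmodule.Build module_of
  module_addA module_addC module_add0 module_addN.

Lemma mvalD u v : mval (u + v)%R = mval u * mval v. Proof. by []. Qed.

(** Since [^] conjugates from the right, the inverse is what makes this a left action. *)
Definition act g u : module_of := to_module (normalJ g^-1 (mvalP u)).

Lemma mval_act g u : mval (act g u) = g * mval u / g.
Proof. by rewrite mvalE conjgE invgK mulgA. Qed.

Lemma act_is_additive g : {morph act g : u v / (u + v)%R}.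
Proof. by move=> u v; apply: mval_inj; rewrite mvalD !mvalE conjMg. Qed.

Lemma act_is_zero g : act g 0%R = 0%R.
Proof. by apply: mval_inj; rewrite !mvalE conj1g. Qed.

HB.instance Definition _ g :=
  GRing.isNmodMorphism.Build module_of module_of (act g)
    (conj (act_is_zero g) (act_is_additive g)).

Lemma actM g h u : act (g * h) u = act g (act h u).
Proof. by apply: mval_inj; rewrite !mvalE invgM conjgM. Qed.

Lemma act1 u : act 1 u = u.
Proof. by apply: mval_inj; rewrite mval_act invg1 mul1g mulg1. Qed.

Lemma act_id g u : normal_carrier M g -> act g u = u.
Proof.
move=> Mg; apply: mval_inj.
by rewrite mval_act (abelian_commute Mg (mvalP u)) mulgK.
Qed.

(** Moving every g to the right leaves the product of the conjugates of u by g^i, i < k, which is a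
    sum in M. *)
Lemma mval_mul_expg u g k :
  (mval u * g) ^+ k = mval (\sum_(i < k) act (g ^+ i) u)%R * g ^+ k.
Proof.
elim: k => [|k IHk]; first by rewrite big_ord0 mulg1.
rewrite expgS IHk big_ord_recl act1 mvalD expgS !mulgA; congr (_ * _).
have -> : (\sum_(i < k) act (g ^+ lift ord0 i) u)%R
          = act g (\sum_(i < k) act (g ^+ i) u)%R.
  by rewrite GRing.raddf_sum; apply: eq_bigr => i _; rewrite expgS actM.
by rewrite mval_act -!mulgA mulVg mulg1.
Qed.

End ConjugationModule.
Arguments mval : simpl never.

(** Both sides run over the pairs (d, i) with d + i < n, grouped by d + i on the left and by d on
    the right. For the classes A_(i,i+d+1) this means by the larger strand and by the width d. *)
Lemma antidiagonal_sum (V : nmodType) (F : nat -> nat -> V) n :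
  (\sum_(j < n) \sum_(i < j.+1) F (j - i)%N i
   = \sum_(d < n) \sum_(i < (n - d)%N) F d i)%R.
Proof.
elim: n => [|n IHn]; first by rewrite !big_ord0.
rewrite big_ord_recr /= IHn [in RHS]big_ord_recr /= subSnn big_ord1.
rewrite [in RHS](eq_bigr (fun d : 'I_n =>
  \sum_(i < (n - d)%N) F d i + F d (n - d)%N)%R) => [|d _]; last first.
  by rewrite subSn ?big_ord_recr // ltnW.
rewrite big_split /= -GRing.addrA; congr (_ + _)%R.
rewrite (reindex_inj rev_ord_inj) big_ord_recr /= subSS subnn subn0.
congr (_ + _)%R; apply: eq_bigr => i _.
by rewrite subSS subKn // ltnW.
Qed.

(** Meant for pairing the widths d and 2m-d-1, which share an orbit of the shift. *)
Lemma folded_sum (V : nmodType) (F : nat -> V) m :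
  (\sum_(d < m.*2) F d = \sum_(d < m) (F d + F (m.*2 - d.+1)%N))%R.
Proof.
rewrite -addnn big_split_ord big_split /=; congr (_ + _)%R.
rewrite (reindex_inj rev_ord_inj); apply: eq_bigr => i _ /=.
by rewrite addnBA.
Qed.

(** * Band classes, the cyclic shift and the full twist *)

Section BraidRelations.
Variables (G : groupType) (M : abelian_normal_subgroup G) (N : nat).
Variable s : nat -> G.
Hypothesis s_far : forall i j, (i.+2 <= j)%N -> commute (s i) (s j).
Hypothesis s_adj : forall i, (i.+1 < N)%N ->
  s i.+1 * s i * s i.+1 = s i * s i.+1 * s i.
Hypothesis s_sq : forall i, normal_carrier M (s i * s i).

(** [N] counts generators, so there are [N.+1] strands; [delta N] is the braid delta, and [delta k]
    its analogue on strands 0 to k. *)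
Definition delta k := \prod_(0 <= i < k) s i.

Lemma delta0 : delta 0 = 1. Proof. exact: big_geq. Qed.

Lemma deltaS k : delta k.+1 = delta k * s k.
Proof. exact: big_nat_recr. Qed.

Lemma delta_far k j : (k < j)%N -> commute (delta k) (s j).
Proof.
elim: k => [|k IHk] lt_kj; first by rewrite delta0; exact/commute_sym/commute1.
rewrite deltaS; apply/commute_sym/commuteM; apply/commute_sym.
  by apply: IHk; lia.
exact: s_far.
Qed.

(** Coming from the right, s_i commutes with the later factors of delta, turns into s_(i+1) by the
    braid relation with s_i s_(i+1), and commutes with the earlier ones. *)
Lemma delta_shift k i : (i.+1 < k)%N -> (k <= N)%N ->
  delta k * s i = s i.+1 * delta k.
Proof.
elim: k => // k IHk; rewrite ltnS leq_eqVlt => /predU1P[<-|lt_ik] le_kN.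
  rewrite !deltaS -!mulgA [s i * _]mulgA -s_adj //.
  by rewrite !mulgA (delta_far (ltnSn i)).
by rewrite deltaS -mulgA -s_far // mulgA IHk ?mulgA //; lia.
Qed.

Definition sq i : module_of M := to_module (s_sq i).

(* Strands are numbered from 0: [band d i] is the class of A_(i, i+d+1). *)
Fixpoint band d i : module_of M :=
  if d is d'.+1 then act (s (i + d)) (band d' i) else sq i.

Lemma act_invol i u : act (s i) (act (s i) u) = u :> module_of M.
Proof. by rewrite -actM act_id. Qed.

Lemma act_far i j u : (i.+2 <= j)%N ->
  act (s i) (act (s j) u) = act (s j) (act (s i) u) :> module_of M.
Proof. by move=> lt_ij; rewrite -!actM s_far. Qed.

Lemma act_shift i j u : (i.+1 < j)%N -> (j <= N)%N ->
  act (delta j) (act (s i) u) = act (s i.+1) (act (delta j) u) :> module_of M.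
Proof. by move=> lt_ij lejN; rewrite -!actM delta_shift. Qed.

Lemma band_shift d i : (i + d.+1 < N)%N -> act (delta N) (band d i) = band d i.+1.
Proof.
elim: d => [|d IHd] lt_N /=; last by rewrite act_shift ?IHd ?addSn //; lia.
apply: mval_inj; rewrite mval_act !mvalE mulgA delta_shift; [|lia..].
by rewrite -(mulgA _ _ (s i)) delta_shift ?mulgA ?mulgK //; lia.
Qed.

(** [band] widens at the right end, here the left end is widened. The two widenings commute, except
    at the narrowest band, where the braid relation takes over. *)
Lemma band_left d i : (i.+1 + d < N)%N -> act (s i) (band d i.+1) = band d.+1 i.
Proof.
elim: d => [|d IHd] lt_N; last first.
  rewrite -[band d.+1 i.+1]/(act (s (i.+1 + d.+1)) (band d i.+1)).
  by rewrite act_far ?IHd /= ?addSnnS //; lia.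
(* As s_(i+1) acts by an involution, it is enough that s_(i+1) s_i conjugates s_(i+1)^2 to s_i^2. *)
rewrite -[LHS](act_invol i.+1) /= addn1; congr (act _ _); rewrite -actM.
apply: mval_inj; rewrite mval_act !mvalE invgM !mulgA.
apply: (mulIg (s i.+1)); rewrite mulgVK; apply: (mulIg (s i)); rewrite mulgVK.
rewrite -2!(mulgA (s i)) -s_adj; last by lia.
by rewrite !mulgA s_adj ?mulgA //; lia.
Qed.

Lemma prod_act_left d i : (i + d < N)%N ->
  act (\prod_(i <= j < i + d) s j) (sq (i + d)) = band d i.
Proof.
elim: d i => [|d IHd] i lt_N; first by rewrite addn0 big_geq // act1.
rewrite big_ltn ?actM; last by lia.
rewrite -!addSnnS IHd ?band_left //; lia.
Qed.

Lemma prod_act_right d i :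
  act (\prod_(i.+1 <= j < i.+1 + d) s j) (band d i) = sq i.
Proof.
elim: d => [|d IHd]; first by rewrite addn0 big_geq // act1.
rewrite addnS big_nat_recr ?actM /=; last by lia.
by rewrite addnS addSn act_invol.
Qed.

Lemma act_sq i : act (s i) (sq i) = sq i.
Proof. by apply: mval_inj; rewrite mval_act !mvalE mulgA mulgK. Qed.

(** Cut delta at s_i: the factors after it narrow A_(i,N) to the class of s_i^2, which s_i fixes,
    and those before it widen this class to A_(0,i+1). *)
Lemma band_wrap d i : i + d.+1 = N -> act (delta N) (band d i) = band i 0.
Proof.
move=> eN; rewrite /delta (@big_cat_nat _ _ _ i) //=; last by lia.
rewrite (@big_ltn _ _ _ i) ?actM; last by lia.
rewrite -eN -addSnnS prod_act_right act_sq.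
by have := @prod_act_left i 0; rewrite !add0n; apply; lia.
Qed.

(** For j <= k+1 this is s_k s_(k-1) ... s_(k-j+1). *)
Definition descent k j := \prod_(0 <= i < j) s (k - i).

(** By [delta_shift] each s_(i+1) crosses [delta k.+1] as s_i; the final s_k of [delta k.+1] then
    starts the longer descent. *)
Lemma descent_delta k j : (j <= k)%N -> (k < N)%N ->
  descent k j * delta k.+1 = delta k * descent k j.+1.
Proof.
move=> le_jk lt_kN; elim: j le_jk => [|j IHj] lt_jk.
  by rewrite /descent big_geq // big_nat1 subn0 mul1g deltaS.
rewrite [in LHS]/descent big_nat_recr //= -/(descent k j).
have -> : k - j = (k - j.+1).+1 by lia.
rewrite -mulgA -delta_shift; [|lia..].
rewrite mulgA IHj; last exact: ltnW.
by rewrite -mulgA [in RHS]/descent big_nat_recr.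
Qed.

Lemma delta_expg k j : (j <= k.+1)%N -> (k < N)%N ->
  delta k.+1 ^+ j = delta k ^+ j * descent k j.
Proof.
move=> le_jk lt_kN; elim: j le_jk => [|j IHj] lt_jk.
  by rewrite /descent big_geq // mulg1.
by rewrite !expgSr IHj 1?ltnW // -mulgA descent_delta // mulgA.
Qed.

(** The braid s_k ... s_0 s_0 ... s_k takes strand k+1 once around strands 0 to k, whence the
    classes A_(i,k+1). Passing to k+1 conjugates it by s_(k+1) and multiplies by s_(k+1)^2. *)
Lemma descent_delta_band k :
  descent k k.+1 * delta k.+1 = mval (\sum_(i < k.+1) band (k - i) i)%R.
Proof.
elim: k => [|k IHk].
  by rewrite /descent big_ord1 big_nat1 deltaS delta0 mul1g mvalE.
rewrite big_ord_recr mvalD /= subnn mvalE.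
have -> : (\sum_(i < k.+1) band (k.+1 - i) i)%R
  = act (s k.+1) (\sum_(i < k.+1) band (k - i) i)%R.
  rewrite GRing.raddf_sum; apply: eq_bigr => i _ /=.
  have -> : k.+1 - i = (k - i).+1 by have := ltn_ord i; lia.
  by rewrite /=; congr (act (s _) _); have := ltn_ord i; lia.
rewrite mval_act -IHk !mulgA mulgVK deltaS mulgA.
by rewrite /descent big_nat_recl.
Qed.

(** By [delta_expg], adding strand k+1 multiplies the twist by the loop of [descent_delta_band]. *)
Lemma full_twist k : (k <= N)%N -> delta k ^+ k.+1
  = mval (\sum_(j < k) \sum_(i < j.+1) band (j - i) i)%R.
Proof.
elim: k => [|k IHk] lt_kN; first by rewrite delta0 expg1n big_ord0.
rewrite expgSr delta_expg // -mulgA descent_delta_band IHk 1?ltnW //.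
by rewrite [in RHS]big_ord_recr mvalD.
Qed.

Lemma act_delta_expg d k : (k + d < N)%N ->
  act (delta N ^+ k) (band d 0) = band d k.
Proof.
elim: k => [|k IHk] lt_N; first by rewrite act1.
by rewrite expgS actM IHk ?band_shift //; lia.
Qed.

(** The shift moves A_(0,d+1) up to A_(N-d-1,N), wraps it to A_(0,N-d) and moves that up in turn, so
    the widths d and N-d-1 share an orbit. *)
Lemma orbit_sum d : (d < N)%N ->
  (\sum_(k < N.+1) act (delta N ^+ k) (band d 0)
   = \sum_(i < N - d) band d i + \sum_(i < d.+1) band (N - d.+1) i)%R.
Proof.
move=> lt_dN; rewrite -(big_mkord xpredT
  (fun k => act (delta N ^+ k) (band d 0))).
rewrite (@big_cat_nat _ _ _ (N - d)) /=; [|lia..].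
congr (_ + _)%R.
  rewrite big_mkord; apply: eq_bigr => i _.
  by apply: act_delta_expg; have := ltn_ord i; lia.
rewrite -{1}[N - d]add0n big_addn big_mkord.
have -> : N.+1 - (N - d) = d.+1 by lia.
apply: eq_bigr => i _.
(* Read from the right: N-d-1 shifts, one wrap, then i shifts. *)
have -> : i + (N - d) = (i + 1 + (N - d.+1))%N by lia.
rewrite !expgnDr !actM act_delta_expg; last by lia.
rewrite band_wrap; last by lia.
by apply: act_delta_expg; have := ltn_ord i; lia.
Qed.

(* For N.+1 strands and N = m.*2, the bands (0, d.+1) with d < m represent the
   orbits of the cyclic shift. *)
Definition half_bands m : module_of M := (\sum_(d < m) band d 0)%R.

Lemma torsion_element m : N = m.*2 ->
  (mval (- half_bands m)%R * delta N) ^+ N.+1 = 1.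
Proof.
move=> eN; rewrite mval_mul_expg full_twist // -mvalD.
suff -> : (\sum_(k < N.+1) act (delta N ^+ k) (- half_bands m)
  = - \sum_(j < N) \sum_(i < j.+1) band (j - i) i)%R.
  by rewrite GRing.addNr.
under eq_bigr => k _ do rewrite GRing.raddfN GRing.raddf_sum.
(* Group the bands of the full twist by width and pair d with N-1-d: each pair is the orbit of one
   summand of [half_bands]. *)
rewrite GRing.sumrN; congr (- _)%R; rewrite antidiagonal_sum exchange_big /=.
rewrite [in RHS]eN.
rewrite (folded_sum (fun d => \sum_(i < (m.*2 - d)%N) band d i)%R).
apply: eq_bigr => d _.
have lt_dm := ltn_ord d.
rewrite orbit_sum; last by lia.
rewrite -eN; congr (_ + _)%R.
by have -> : N - (N - d.+1) = d.+1 by lia.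
Qed.

End BraidRelations.

(** * Quotients and the abelianization of a normal subgroup *)

Section Quotient.
Variables (G H : groupType) (K : normal_subgroup G).

Definition quotient_proj : G -> quotient_group K := \pi_(quotient_group K).

Lemma quotient_proj_is_monoid_morphism : monoid_morphism quotient_proj.
Proof. by split=> // x y; rewrite [RHS]quotient_mulE. Qed.

HB.instance Definition _ := isUMagmaMorphism.Build G (quotient_group K)
  quotient_proj quotient_proj_is_monoid_morphism.

Lemma quotient_proj_eq1 x : quotient_proj x = 1 <-> normal_carrier K x.
Proof.
by rewrite -[1]/(quotient_proj 1) quotient_eqP divg1.
Qed.

(** The kernel of h is a subgroup containing the commutators that generate [K, K]. *)
Lemma derived_killed (h : UMagmaMorphism.type G H) :
  (forall x y, normal_carrier K x -> normal_carrier K y -> commute (h x) (h y)) ->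
  forall z, normal_carrier (derived K) z -> h z = 1.
Proof.
move=> hK z Kz; apply: (Kz (kernel h)); first exact: kernel_is_subgroup.
move=> _ [x [y [Kx Ky ->]]]; rewrite /kernel /= gmulfR; apply/eqP/commgP.
exact: hK.
Qed.

End Quotient.

Section Abelianization.
Variables (G : groupType) (K : normal_subgroup G).
Local Notation p := (@quotient_proj G (derived K)).

Definition abelianization_carrier : set (quotient_group (derived K)) :=
  [set q | exists2 x, normal_carrier K x & q = p x].

Lemma abelianization_is_subgroup : is_subgroup abelianization_carrier.
Proof.
split; first by exists 1; [exact: normal1 | rewrite gmulf1].
move=> _ _ [x Kx ->] [y Ky ->]; exists (x / y); first exact: normalB.
by rewrite gmulfF.
Qed.

Lemma abelianization_is_normal : is_normal abelianization_carrier.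
Proof.
move=> _ q [x Kx ->]; elim/quotient_ind: q => y.
by exists (x ^ y); [exact: normalJ | rewrite gmulfJ].
Qed.

Lemma abelianization_commute q r : abelianization_carrier q ->
  abelianization_carrier r -> commute q r.
Proof.
move=> [x Kx ->] [y Ky ->]; apply/commgP/eqP; rewrite -gmulfR.
by apply/quotient_proj_eq1 => S _; apply; exists x, y.
Qed.

Definition abelianization : abelian_normal_subgroup (quotient_group (derived K)) :=
  @AbelianNormalSubgroup _
    (NormalSubgroup abelianization_is_subgroup abelianization_is_normal)
    abelianization_commute.

End Abelianization.

(** * The wreath product of Z and S_n, and crossing numbers *)

Lemma word_eval_nil (I : choiceType) (H : groupType) (f : I -> H) :
  word_eval f [::] = 1.
Proof. exact: big_nil. Qed.

Lemma word_eval_letter n (H : groupType) (f : 'I_n.-1 -> H) i w :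
  word_eval f (letter i :: w) = f i * word_eval f w.
Proof. exact: big_cons. Qed.

Section Wreath.
Variable n : nat.

(* A fresh name, because the product of types already carries the componentwise
   group structure. *)
Definition wreath : Type := ({ffun 'I_n -> int} * 'S_n)%type.
HB.instance Definition _ := Choice.on wreath.
Implicit Types x y z : wreath.

Definition wreath_one : wreath := (0%R, 1).
(** The strand that starts at k leaves x at [x.2 k], and there y adds its count. *)
Definition wreath_mul x y : wreath :=
  ([ffun k => x.1 k + y.1 (x.2 k)]%R, x.2 * y.2).
Definition wreath_inv x : wreath := ([ffun k => - x.1 (x.2^-1 k)%g]%R, x.2^-1).

Lemma wreath_mulA : associative wreath_mul.
Proof.
move=> x y z; congr (_, _); last exact: mulgA.
by apply/ffunP=> k; rewrite !ffunE permM GRing.addrA.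
Qed.

Lemma wreath_mul1g : left_id wreath_one wreath_mul.
Proof.
move=> [f s]; congr (_, _); last exact: mul1g.
by apply/ffunP=> k; rewrite !ffunE perm1 GRing.add0r.
Qed.

Lemma wreath_mulg1 : right_id wreath_one wreath_mul.
Proof.
move=> [f s]; congr (_, _); last exact: mulg1.
by apply/ffunP=> k; rewrite !ffunE GRing.addr0.
Qed.

Lemma wreath_mulVg : left_inverse wreath_one wreath_inv wreath_mul.
Proof.
move=> [f s]; congr (_, _); last exact: mulVg.
by apply/ffunP=> k; rewrite !ffunE /= GRing.addNr.
Qed.

Lemma wreath_mulgV : right_inverse wreath_one wreath_inv wreath_mul.
Proof.
move=> [f s]; congr (_, _); last exact: mulgV.
by apply/ffunP=> k; rewrite !ffunE /= permK GRing.addrN.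
Qed.

HB.instance Definition _ := isGroup.Build wreath
  wreath_mulA wreath_mul1g wreath_mulg1 wreath_mulVg wreath_mulgV.

Lemma wreath_mulE x y k : (x * y).1 k = (x.1 k + y.1 (x.2 k))%R.
Proof. by rewrite ffunE. Qed.

Definition wreath_perm : wreath -> 'S_n := snd.
Lemma wreath_perm_is_monoid_morphism : monoid_morphism wreath_perm.
Proof. by []. Qed.
HB.instance Definition _ := isUMagmaMorphism.Build wreath 'S_n
  wreath_perm wreath_perm_is_monoid_morphism.

Lemma wreath_commute x y :
  wreath_perm x = 1 -> wreath_perm y = 1 -> commute x y.
Proof.
case: x y => [f s] [g t]; rewrite /wreath_perm /= => -> ->.
congr (_, _); apply/ffunP=> k.
by rewrite !ffunE !perm1 GRing.addrC.
Qed.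

Lemma wreath_expg x m k : wreath_perm x = 1 -> (x ^+ m).1 k = (x.1 k *+ m)%R.
Proof.
rewrite /wreath_perm => x1; elim: m => [|m IHm]; first by rewrite ffunE.
by rewrite expgS wreath_mulE x1 perm1 IHm GRing.mulrS.
Qed.

(** Compare strand k in z x^m = x^m (z ^ x^m): x^m counts 0 at k, and m times the count of x at the
    image of k under z. *)
Lemma wreath_conjg_expg x z m k : wreath_perm x = 1 -> x.1 k = 0%R ->
  (z ^ (x ^+ m)).1 k = (z.1 k + x.1 (z.2 k) *+ m)%R.
Proof.
move=> x1 xk; have := congr1 (fun y => y.1 k) (conjgC z (x ^+ m)).
have xm1 : (x ^+ m).2 = 1.
  by rewrite -[_.2]/(wreath_perm _) gmulfXn; rewrite /= x1 expg1n.
by rewrite !wreath_mulE xm1 perm1 !wreath_expg // xk GRing.mul0rn GRing.add0r.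
Qed.

Definition touches (i k : nat) : bool := (k == i) || (k == i.+1).

Definition crossing (i : 'I_n.-1) : wreath :=
  ([ffun k : 'I_n => Posz (touches i k)], adjacent_transposition i).

Lemma adjacent_transposition_val (i : 'I_n.-1) (k : 'I_n) :
  adjacent_transposition i k
  = (if k == i :> nat then i.+1
     else if k == i.+1 :> nat then (i : nat) else k) :> nat.
Proof.
rewrite /adjacent_transposition; case: tpermP => [->|->|/eqP ki /eqP ki1] /=.
- by rewrite eqxx.
- by rewrite eqxx; case: ifP => //; lia.
- by rewrite -!val_eqE /= in ki ki1; rewrite (negPf ki) (negPf ki1).
Qed.

(** In the braid relation any two of the three strands cross once on either side, so each strand
    counts 2 on both. *)
Lemma crossing_rel (u v : word 'I_n.-1) :
  braid_rel u v -> word_eval crossing u = word_eval crossing v.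
Proof.
move=> uv.
have perm_eval w : wreath_perm (word_eval crossing w)
    = word_eval (@adjacent_transposition n) w.
  by rewrite /word_eval gmulf_prod; apply: eq_bigr => -[i []].
suff e : (word_eval crossing u).1 = (word_eval crossing v).1.
  move: (perm_eval u) (perm_eval v); rewrite /wreath_perm.
  rewrite (adjacent_transposition_rel uv) => <-.
  by case: (word_eval crossing u) (word_eval crossing v) e => f s [g t] /= -> ->.
case: uv => i j ij; rewrite !word_eval_letter word_eval_nil !mulg1.
  apply/ffunP=> k; rewrite !wreath_mulE !ffunE !adjacent_transposition_val /touches.
  by do ![case: eqP => ? //=; try lia].
apply/ffunP=> k; rewrite !wreath_mulE !ffunE ?permM.
rewrite !adjacent_transposition_val /touches ij.
by do ![case: eqP => ? //=; try lia].
Qed.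

End Wreath.

(** Turns an equality of classes of words into an equation between products of generators. *)
Lemma word_eval_pres_gen (I : choiceType) (R : word I -> word I -> Prop) u :
  word_eval (pres_gen R) u = \pi_(presented_group R) u.
Proof.
elim: u => [|[i b] u IHu]; first by rewrite word_eval_nil.
rewrite /word_eval big_cons -/(word_eval _ u) IHu.
case: b => /=; first by rewrite [LHS]pres_mulE.
by rewrite [X in X * _]pres_invE [LHS]pres_mulE.
Qed.

(** * The torsion element of B_n/[P_n, P_n] *)

Section BraidTorsion.
Variable n : nat.

(* The trivial braid when k >= n.-1. *)
Definition artin_gen (k : nat) : braid_group n :=
  oapp (pres_gen (@braid_rel n)) 1 (insub k).

Lemma artin_gen_ord (i : 'I_n.-1) : artin_gen i = pres_gen (@braid_rel n) i.
Proof. by rewrite /artin_gen valK. Qed.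

(** This default lets far commutation and purity of squares hold for all indices, as
    [BraidRelations] assumes. *)
Lemma artin_gen_out k : (n.-1 <= k)%N -> artin_gen k = 1.
Proof. by move=> le_nk; rewrite /artin_gen insubN // -leqNgt. Qed.

Lemma artin_gen_far i j : (i.+2 <= j)%N -> commute (artin_gen i) (artin_gen j).
Proof.
move=> lt_ij; case: (ltnP j n.-1) => [lt_jn|/artin_gen_out->]; last exact: commute1.
have lt_in : (i < n.-1)%N by lia.
rewrite (artin_gen_ord (Ordinal lt_in)) (artin_gen_ord (Ordinal lt_jn)).
have /pres_rel/pres_eqP := @braid_rel_far n (Ordinal lt_in) (Ordinal lt_jn)
  (introT orP (or_introl lt_ij)).
by rewrite -!word_eval_pres_gen !word_eval_letter word_eval_nil !mulg1.
Qed.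

Lemma artin_gen_adj i : (i.+1 < n.-1)%N ->
  artin_gen i.+1 * artin_gen i * artin_gen i.+1
  = artin_gen i * artin_gen i.+1 * artin_gen i.
Proof.
move=> lt_jn; have lt_in : (i < n.-1)%N by lia.
rewrite (artin_gen_ord (Ordinal lt_in)) (artin_gen_ord (Ordinal lt_jn)).
have /pres_rel/pres_eqP :=
  @braid_rel_adjacent n (Ordinal lt_in) (Ordinal lt_jn) erefl.
by rewrite -!word_eval_pres_gen !word_eval_letter word_eval_nil !mulg1 !mulgA.
Qed.

Lemma braid_permM (x y : braid_group n) :
  braid_perm (x * y) = braid_perm x * braid_perm y.
Proof. exact: gmulfM. Qed.

Lemma braid_perm_gen (i : 'I_n.-1) :
  braid_perm (artin_gen i) = adjacent_transposition i.
Proof. by rewrite artin_gen_ord; exact: pres_lift_gen. Qed.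

Lemma artin_gen_sq_pure i :
  normal_carrier (pure_braid_group n) (artin_gen i * artin_gen i).
Proof.
rewrite /= /kernel /= braid_permM.
case: (ltnP i n.-1) => [lt_in|/artin_gen_out->]; last by rewrite gmulf1 mulg1.
rewrite (braid_perm_gen (Ordinal lt_in)).
by rewrite /adjacent_transposition tperm2.
Qed.

Definition crossing_number : braid_group n -> wreath n :=
  pres_lift (@crossing_rel n).
HB.instance Definition _ := UMagmaMorphism.on crossing_number.

Lemma crossing_number_perm x : wreath_perm (crossing_number x) = braid_perm x.
Proof.
elim/pres_ind: x => u.
rewrite /crossing_number /braid_perm !pres_liftE /word_eval gmulf_prod.
by apply: eq_bigr => -[i []].
Qed.

Lemma crossing_number_sq k (i : 'I_n) : (k < n.-1)%N ->
  (crossing_number (artin_gen k * artin_gen k)).1 i = Posz (touches k i).*2.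
Proof.
move=> lt_kn; rewrite [crossing_number _]gmulfM /=.
rewrite (artin_gen_ord (Ordinal lt_kn)) [crossing_number _]pres_lift_gen.
rewrite wreath_mulE !ffunE adjacent_transposition_val /touches /=.
by do ![case: eqP => ? //=; try lia].
Qed.

Lemma crossing_number_derived x :
  normal_carrier (derived (pure_braid_group n)) x -> crossing_number x = 1.
Proof.
apply: derived_killed => y z py pz.
by apply: wreath_commute; rewrite crossing_number_perm.
Qed.

Definition braid_cycle : braid_group n := delta artin_gen n.-1.

(** Permutations compose left factor first, so [act g] moves the ends of bands by the inverse
    permutation: points go down here while bands go up in [band_shift]. *)
Lemma braid_perm_delta k (i : 'I_n) : (k < n)%N ->
  braid_perm (delta artin_gen k) i
  = (if (i <= k)%N then if i == 0 :> nat then k else i.-1 else i) :> nat.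
Proof.
elim: k i => [|k IHk] i lt_kn.
  by rewrite delta0 gmulf1 perm1; case: ifP => //; case: ifP; lia.
have lt_k : (k < n.-1)%N by lia.
rewrite deltaS braid_permM permM (braid_perm_gen (Ordinal lt_k)).
rewrite adjacent_transposition_val IHk ?(ltnW lt_kn) //=.
by do ![case: ifP]; lia.
Qed.

(** The permutation will bound the order from below and help to separate the conjugates. *)
Lemma exists_torsion : odd n -> exists2 x : braid_group n,
  @quotient_proj _ (derived (pure_braid_group n)) x ^+ n = 1
  & braid_perm x = braid_perm braid_cycle.
Proof.
move=> n_odd; have eN : n.-1 = (n./2).*2 by have := odd_double_half n; lia.
pose p := @quotient_proj _ (derived (pure_braid_group n)).
pose M := abelianization (pure_braid_group n).
have far i j : (i.+2 <= j)%N -> commute (p (artin_gen i)) (p (artin_gen j)).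
  by move=> lt_ij; apply/gmulf_commute/artin_gen_far.
have adj i : (i.+1 < n.-1)%N ->
    p (artin_gen i.+1) * p (artin_gen i) * p (artin_gen i.+1)
    = p (artin_gen i) * p (artin_gen i.+1) * p (artin_gen i).
  by move=> lt_i; rewrite -!gmulfM artin_gen_adj.
have sqM i : normal_carrier M (p (artin_gen i) * p (artin_gen i)).
  rewrite -gmulfM; exists (artin_gen i * artin_gen i) => //.
  exact: artin_gen_sq_pure.
have := torsion_element far adj sqM eN.
(* Elements of [M] are images of pure braids, so y is a pure lift of minus [half_bands], and y delta
   has the permutation of delta. *)
have [y py ->] := mvalP (- half_bands sqM n./2)%R.
have -> : delta (p \o artin_gen) n.-1 = p braid_cycle by rewrite [RHS]gmulf_prod.
rewrite -gmulfM => tors; exists (y * braid_cycle).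
  by rewrite -[in X in _ ^+ X](@prednK n) //; lia.
by rewrite braid_permM [braid_perm y]py mul1g.
Qed.

End BraidTorsion.

Theorem proposition19 (n : nat) (n_ge3 : (3 <= n)%N) (n_odd : odd n) :
  infinite_set
    [set x : quotient_group (derived (pure_braid_group n)) | has_order x n].
Proof.
have [a a_tors a_perm] := exists_torsion n_odd.
pose p := @quotient_proj _ (derived (pure_braid_group n)).
have cycleE (i : 'I_n) : i != 0 :> nat -> braid_perm a i = i.-1 :> nat.
  move=> i0; rewrite a_perm braid_perm_delta; last by lia.
  by rewrite (negPf i0) ifT //; have := ltn_ord i; lia.
have a_order : has_order (p a) n.
  split=> // [|k /andP[k_gt0 lt_kn] ak]; first by lia.
  have /(congr1 (@wreath_perm n)) : crossing_number (a ^+ k) = 1.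
    by apply/crossing_number_derived/quotient_proj_eq1; rewrite gmulfXn.
  rewrite crossing_number_perm => /perm.permP /(_ (Ordinal lt_kn)).
  (* The point k goes down to 0 in exactly k steps, before the cycle wraps around, so a^k moves
     it. *)
  have powE j (le_jk : (j <= k)%N) :
      braid_perm (a ^+ j) (Ordinal lt_kn) = k - j :> nat.
    elim: j le_jk => [|j IHj] lt_jk; first by rewrite gmulf1 perm1 subn0.
    by rewrite expgSr braid_permM permM cycleE IHj; lia.
  by move=> /(congr1 val) /=; rewrite powE // perm1 /=; lia.
pose t := artin_gen n 0 * artin_gen n 0.
have t_perm : wreath_perm (crossing_number t) = 1.
  by rewrite crossing_number_perm; exact: artin_gen_sq_pure.
have tE (i : 'I_n) : (crossing_number t).1 i = Posz (touches 0 i).*2.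
  by apply: crossing_number_sq; lia.
have pJ x y : p (x ^ y) = p x ^ p y by exact: gmulfJ.
have conj_order k : has_order (p (a ^ (t ^+ k))) n.
  case: a_order => n_gt0 a1 aN; rewrite pJ; split=> // [|j /aN aj].
    by rewrite -conjXg a1 conj1g.
  by rewrite -conjXg => /eqP; rewrite conjg_eq1 => /eqP.
have conj_inj k l : p (a ^ (t ^+ k)) = p (a ^ (t ^+ l)) -> k = l.
  move=> /quotient_eqP/crossing_number_derived.
  rewrite gmulfF => /divg1_eq; rewrite !gmulfJ !gmulfXn /=.
  (* The point 2 is not touched by t, but a takes it to 1, where t counts 2. Conjugation by t^k
     therefore adds 2k to the count of a at 2. *)
  pose i := Ordinal (n_ge3 : (2 < n)%N).
  have ti : (crossing_number t).1 i = 0%R by rewrite tE.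
  move/(congr1 (fun y : wreath n => y.1 i)); rewrite !wreath_conjg_expg //.
  move/GRing.addrI; rewrite tE.
  have -> : touches 0 ((crossing_number a).2 i) = true.
    rewrite -[_.2]/(wreath_perm _) crossing_number_perm.
    by rewrite /touches cycleE.
  lia.
move=> fin; apply: infinite_nat.
rewrite (_ : [set: nat]
  = (fun k => p (a ^ (t ^+ k))) @^-1` [set x | has_order x n]).
  by apply: finite_preimage fin => k l _ _; exact: conj_inj.
by apply/esym/seteqP; split=> k // _; exact: conj_order.
Qed.
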